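(* Let $m,n$ be relatively prime positive integers and let $\ell$ be an integer with $0<\ell<mn$. Then $$S_{m,n,\ell}(q,t,a)=\sum_{k\ge 0}a^k\left(\sum_{\pi\in \mathrm{D}(m,n,\ell)}q^{\mathrm{area}(\pi)}\,t^{\mathrm{dinv}(\pi)}\sum_{\substack{L\subset \mathrm{AB}(\pi)\\ |L|=k}}t^{-\sum_{\Box\in L}\xi(\pi,\Box)}\right).$$
   Context: Boxes and partitions. A box is a unit square in the plane with integer corners, identified with its northeast corner $(x,y)\in\mathbb{Z}^2$. A partition $\lambda=(\lambda_1\ge\lambda_2\ge\dots)$ is identified with the set of boxes $\{(x,y): y\ge 1,\ 1\le x\le\lambda_y\}$ (French convention), with $\lambda_y=0$ for all $y$ beyond the number of rows. Dyck paths. For coprime positive integers $m,n$ and an integer $0<\ell<mn$, let $\tau_{m,n,\ell}=\{(x,y)\in\mathbb{Z}_{\ge1}^2: nx+my\le \ell\}$. $\mathrm{D}(m,n,\ell)$ is the set of pairs $\pi=(\lambda,\tau_{m,n,\ell})$ with $\lambda\subset\tau_{m,n,\ell}$ a partition (possibly empty). $\mathrm{area}(\pi)=|\tau_{m,n,\ell}|-|\lambda|$. $\mathrm{dinv}(\pi)$ is the number of boxes $\Box\in\lambda$ with $\frac{\mathrm{leg}(\Box)}{\mathrm{arm}(\Box)+1}<\frac nm\le\frac{\mathrm{leg}(\Box)+1}{\mathrm{arm}(\Box)}$, where $\mathrm{leg}(\Box)$ (resp. $\mathrm{arm}(\Box)$) is the number of boxes of $\lambda$ strictly above $\Box$ in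 its column (resp. strictly to the right of $\Box$ in its row), and the right-hand fraction is $+\infty$ if $\mathrm{arm}(\Box)=0$. $\mathrm{AB}(\pi)$ is the set of addable boxes of $\lambda$, i.e. boxes $\Box\in\mathbb{Z}_{\ge 1}^2\setminus\lambda$ such that $\lambda\cup\{\Box\}$ is a partition. $\mathrm{EB}(\pi)$ is the set of boxes in $\mathbb{Z}\times\{1,\dots,n\}$ whose east side is a vertical step of the lattice path from $(0,n)$ to $(m,0)$ following the boundary of $\lambda$; that is, $\mathrm{EB}(\pi)=\{(\lambda_y,y):1\le y\le n\}$. With $\gamma(x,y)=mn-nx-my$, for $\Box\in \mathrm{AB}(\pi)$ set $$\xi(\pi,\Box)=|\{\Box'\in \mathrm{EB}(\pi): \gamma(\Box)+n<\gamma(\Box')\le\gamma(\Box)+n+m\}|.$$ Triangular Schröder polynomial. Let $\Gamma_{m,n}=\{nx+my: x,y\in\mathbb{Z}_{\ge0}\}$. $\mathrm{Inv}_{m,n}$ is the set of $\Delta\subset\mathbb{Z}_{\ge0}$ with $\Delta+m\subset\Delta$ and $\Delta+n\subset\Delta$. For such $\Delta$ put $\overline\Delta=\mathbb{Z}_{\ge0}\setminus\Delta$, $n\text{-}\mathrm{gen}(\Delta)=\{k\in\Delta:k-n\notin\Delta\}$, $\mathrm{cogen}_{\ge0}(\Delta)=\{k\in\mathbb{Z}_{\ge0}\setminus\Delta: k+n\in\Delta,\ k+m\in\Delta\}$, $\xi_k(\Delta)=|\{x\in n\text{-}\mathrm{gen}(\Delta): n+k+1\le x\le n+k+m\}|$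 for $k\in\mathbb{Z}$, $\mathrm{area}'(\Delta)=|\overline\Delta\cap\mathbb{Z}_{\ge n+m}|$, and $$\mathrm{codinv}'(\Delta)=\sum_{x\in n\text{-}\mathrm{gen}(\Delta)}|\overline\Delta\cap\mathbb{Z}_{\ge n+m}\cap[x,x+m-1]|-\binom{\xi_{-1}(\Delta)}{2}.$$ Let $\mathbf{w}(m,n,\ell)=(w_0,\dots,w_{m+n-1})\in\{0,1\}^{m+n}$ with $w_i=1$ iff $i+mn-\ell-(n+m)\in\Gamma_{m,n}$, and let $\mathrm{Inv}_{\mathbf{w}(m,n,\ell)}$ be the set of $\Delta\in\mathrm{Inv}_{m,n}$ such that for $0\le i\le m+n-1$: $i\in\Delta$ iff $w_i=1$. The triangular Schröder polynomial is $$S_{m,n,\ell}(q,t,a)=t^{|\tau_{m,n,\ell}|}\sum_{\Delta\in\mathrm{Inv}_{\mathbf{w}(m,n,\ell)}}q^{\mathrm{area}'(\Delta)}t^{-\mathrm{codinv}'(\Delta)}\prod_{k\in\mathrm{cogen}_{\ge0}(\Delta)}\bigl(1+at^{-\xi_k(\Delta)}\bigr).$$ *)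

(* Defs.v *)
From HB Require Import structures.
From mathcomp Require Import all_boot all_order all_algebra finmap.
From mathcomp Require Import boolp classical_sets functions cardinality fsbigop.

Set Implicit Arguments.
Unset Strict Implicit.
Unset Printing Implicit Defensive.

Import Order.TTheory GRing.Theory Num.Theory.

Local Open Scope classical_set_scope.
Local Open Scope ring_scope.

(* Number of elements of a set; only meaningful (and only used below) for
   finite sets, since [fset_set A] is empty when [A] is infinite. *)
Definition ncard (T : choiceType) (A : set T) : nat := size (fset_set A).

(** Partitions and Dyck paths *)

(* A box is named by its northeast corner; every box that occurs below has
   nonnegative coordinates, so [nat] is used instead of [int]. *)
Definition box : Type := (nat * nat)%type.

Definition is_partition (la : seq nat) : bool :=
  sorted geq la && (0%N \notin la).

(* The [y]-th part, for [1 <= y]; it is 0 beyond the number of rows. *)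
Definition part (la : seq nat) (y : nat) : nat := nth 0%N la y.-1.

Definition boxes (la : seq nat) : set box :=
  [set b | (1 <= b.2)%N /\ (1 <= b.1 <= part la b.2)%N].

Definition tau (m n : nat) (l : int) : set box :=
  [set b | [/\ (1 <= b.1)%N, (1 <= b.2)%N & (n * b.1 + m * b.2)%N%:Z <= l]].

(* A path [(la, tau m n l)] is represented by its first component [la], the
   second one being determined by [m], [n] and [l]. *)
Definition Dyck (m n : nat) (l : int) : set (seq nat) :=
  [set la | is_partition la /\ boxes la `<=` tau m n l].

Definition area (m n : nat) (l : int) (la : seq nat) : nat :=
  (ncard (tau m n l) - ncard (boxes la))%N.

Definition arm (la : seq nat) (b : box) : nat :=
  ncard [set b' | [/\ boxes la b', b'.2 = b.2 & (b.1 < b'.1)%N]].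

Definition leg (la : seq nat) (b : box) : nat :=
  ncard [set b' | [/\ boxes la b', b'.1 = b.1 & (b.2 < b'.2)%N]].

(* [x / 0] is 0 in [rat], so the case of a zero arm is treated separately: the
   upper bound is then [+oo]. *)
Definition dinv (m n : nat) (la : seq nat) : nat :=
  ncard [set b | [/\ boxes la b,
    (leg la b)%:R / (arm la b).+1%:R < n%:R / m%:R :> rat &
    arm la b = 0%N \/
    n%:R / m%:R <= (leg la b).+1%:R / (arm la b)%:R :> rat]].

Definition AB (la : seq nat) : set box :=
  [set b | [/\ (1 <= b.1)%N, (1 <= b.2)%N, ~ boxes la b &
    exists2 mu, is_partition mu & boxes mu = boxes la `|` [set b]]].

Definition EB (n : nat) (la : seq nat) : set box :=
  [set b | (1 <= b.2 <= n)%N /\ b.1 = part la b.2].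

Definition gamma (m n : nat) (b : box) : int :=
  (m * n)%N%:Z - (n * b.1)%N%:Z - (m * b.2)%N%:Z.

Definition xi_box (m n : nat) (la : seq nat) (b : box) : nat :=
  ncard [set b' | EB n la b' /\
    gamma m n b + n%:Z < gamma m n b' <= gamma m n b + n%:Z + m%:Z].

(** Invariant subsets and the triangular Schröder polynomial *)

Definition Gamma (m n : nat) : set int :=
  [set k | exists x y : nat, k = (n * x + m * y)%N%:Z].

Definition Inv (m n : nat) : set (set int) :=
  [set D | [/\ D `<=` [set k | 0 <= k],
    (forall k, D k -> D (k + m%:Z)) & (forall k, D k -> D (k + n%:Z))]].

Definition gaps (D : set int) : set int := [set k | 0 <= k] `\` D.

Definition ngen (n : nat) (D : set int) : set int :=
  [set k | D k /\ ~ D (k - n%:Z)].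

Definition cogen (m n : nat) (D : set int) : set int :=
  [set k | [/\ 0 <= k, ~ D k, D (k + n%:Z) & D (k + m%:Z)]].

Definition xi (m n : nat) (D : set int) (k : int) : nat :=
  ncard [set x | ngen n D x /\ n%:Z + k + 1 <= x <= n%:Z + k + m%:Z].

Definition area' (m n : nat) (D : set int) : nat :=
  ncard (gaps D `&` [set k | (n + m)%N%:Z <= k]).

Definition codinv' (m n : nat) (D : set int) : int :=
  (\sum_(x \in ngen n D)
     (ncard (gaps D `&` [set k | (n + m)%N%:Z <= k]
                   `&` [set k | x <= k <= x + m%:Z - 1]))%:Z)
  - ('C(xi m n D (-1), 2))%:Z.

Definition w (m n : nat) (l : int) : (m + n).-tuple bool :=
  [tuple `[< Gamma m n ((i : nat)%:Z + (m * n)%N%:Z - l - (n + m)%N%:Z) >]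
     | i < m + n].

Definition Inv_w (m n : nat) (v : (m + n).-tuple bool) : set (set int) :=
  [set D | Inv m n D /\ forall i : 'I_(m + n), D (i : nat)%:Z <-> tnth v i].

(* The Laurent polynomial is given by its values at elements [q], [t], [a] of a
   commutative ring in which [t] is invertible; the formal polynomial is the
   case of the indeterminates of Z[q, t^{+-1}, a]. *)
Definition Schroeder (m n : nat) (l : int) (R : comUnitRingType) (q t a : R)
    : R :=
  t ^+ ncard (tau m n l) *
  \sum_(D \in Inv_w (w m n l))
    (q ^+ area' m n D * t ^ (- codinv' m n D) *
     \big[*%R/1]_(k \in cogen m n D) (1 + a * t ^ (- (xi m n D k)%:Z))).

(* Main.v *)
Require Import Defs.
From mathcomp Require Import all_boot all_order all_algebra finmap.
From mathcomp Require Import boolp classical_sets functions cardinality fsbigop.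
From mathcomp Require Import zify.

Set Implicit Arguments.
Unset Strict Implicit.
Unset Printing Implicit Defensive.

Import Order.TTheory GRing.Theory Num.Theory.

Local Open Scope classical_set_scope.
Local Open Scope ring_scope.

(** The identity holds because a subset [Delta] in [Inv_w (w m n l)] is a
    partition inside [tau] in disguise. As [m] and [n] are coprime, every integer
    is [l - n * i - m * j] for a unique pair of an integer [i] and [j < n]. With
    rows and columns numbered from 0, the box [(i, j)] is placed at this integer;
    the boxes of [tau] are then the points with [0 <= i] at integers at least
    [n + m], and the translate of [Gamma] that defines [w] is the half-plane
    [i < 0]. Prescribing [Delta] below [n + m] thus means prescribing that it
    agrees there with [i < 0], and its remaining freedom is which boxes of [tau]
    it contains. Closure under adding [n] and [m] says that these boxes form a
    partition [la] ([Dset_bij]).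

    The statistics are read off in these coordinates. The gaps from [n + m] on are
    the boxes of [tau] outside [la] ([area'_sum]); the cogenerators are the
    addable boxes ([AB_cogen]); the [n]-generators that are at least [n] are the
    last boxes of the rows ([ngenP]), so that [xi] counts the boxes of [EB]
    ([xi_box_pt]). Expanding the product over the addable boxes
    ([prod_1D_subsets]) produces the sum over the sets [L], and what remains is
    [|tau| - codinv' = dinv] ([codinv'_dinv]).

    The binomial in [codinv'] vanishes, because [xi] at -1 is at most 1
    ([xi_le1]). The rest of [codinv'] counts the pairs of a row of [la] and a box
    of [tau] outside [la] whose integer lies within [m] after the end of that row.
    That this count and [dinv] add up to [|tau|] is shown by growing [la] one box
    at a time, each row from left to right and the rows from the bottom up
    ([dinvf_codinvf]). For the empty partition [dinv] is 0 and each box of [tau]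
    lies in the window of exactly one row. When a box is added, both counts
    change by numbers of rows whose end lies in given windows relative to the new
    box. For the rows below, the windows cancel up to boundary values that
    coprimality excludes; the rows above are empty, so that their ends form an
    arithmetic progression and are counted exactly ([dinvf_codinvf_add]). *)

(** * Counting *)

(** Each summand marks the step at which [A - d * s] passes from above [c] to [c]
    or below, and a nonincreasing sequence does so at most once. *)
Lemma sum_window (d : nat) (A c : int) (N : nat) :
  ((\sum_(s < N) (A - d%:Z * s.+1%:Z <= c < A - d%:Z * s%:Z)%R) +
    (c < A - d%:Z * N%:Z)%R)%N = (c < A)%R.
Proof.
elim: N => [|N IH]; first by rewrite big_ord0 mulr0 subr0.
rewrite big_ord_recr /= -[in RHS]IH.
have -> : d%:Z * N.+1%:Z = d%:Z * N%:Z + d%:Z :> int by lia.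
by move: (d%:Z * N%:Z) (bigop.body _ _ _) {IH} => x S; lia.
Qed.

Lemma sum_between (n j Z : nat) : (Z <= n)%N ->
  (\sum_(k < n) ((j < k) && (k < Z)) = Z - j.+1)%N.
Proof.
move=> /subnKC <-; elim: (n - Z)%N => [|p IH].
  rewrite addn0; elim: Z => [|Z IH]; first by rewrite big_ord0.
  rewrite big_ord_recr /= (eq_bigr (fun k : 'I_Z => nat_of_bool ((j < k) && (k < Z))%N)).
    by rewrite IH; lia.
  by move=> k _; have := ltn_ord k; lia.
by rewrite addnS big_ord_recr /= IH; lia.
Qed.

(** Coprimality in the form that keeps apart the integers in distinct rows: the
    rows are numbered below [n], and [s] is the difference of two of them. *)
Lemma coprime_mul_eq (m n A s : nat) : coprime m n -> (n * A = m * s)%N ->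
  (s < n)%N -> s = 0%N.
Proof.
move=> cmn e ltsn; apply/eqP; rewrite -leqn0 leqNgt; apply/negP => s0.
have : (n %| s)%N by rewrite -(@Gauss_dvdr n m) 1?coprime_sym // -e dvdn_mulr.
by move/(dvdn_leq s0); lia.
Qed.

Lemma sum_single (n m Y a : nat) (Q : nat -> nat -> bool) :
  (Y < n)%N -> (a < m)%N ->
  (\sum_(k < n) \sum_(i < m) [&& k == Y :> nat, i == a :> nat & Q k i] = Q Y a)%N.
Proof.
move=> hY ha; rewrite (bigD1 (Ordinal hY)) //= (bigD1 (Ordinal ha)) //= !eqxx /=.
rewrite big1 ?big1 ?addn0 // => [k|i].
  by rewrite -val_eqE /= => /negPf-> ; rewrite big1.
by rewrite -val_eqE /= => /negPf->.
Qed.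

Lemma nth_sorted_geq (la : seq nat) (j k : nat) : sorted geq la ->
  (j <= k)%N -> (nth 0%N la k <= nth 0%N la j)%N.
Proof.
move=> srt jk; case: (ltnP k (size la)) => [ks|sk]; last by rewrite nth_default.
have tr : transitive geq by move=> ? ? ? /= h1 h2; apply: leq_trans h2 h1.
apply: (sorted_leq_nth tr leqnn 0%N srt) => //.
by rewrite inE (leq_ltn_trans jk).
Qed.

Lemma ncardE (U : choiceType) (A : set U) (s : seq U) : uniq s ->
  (forall u, A u <-> u \in s) -> ncard A = size s.
Proof.
move=> us As; have -> : A = [set` s] by apply/seteqP; split=> u /As.
rewrite /ncard; apply/perm_size/uniq_perm => // u.
by rewrite in_fset_set ?mem_setE //; exact: finite_seq.
Qed.

(** With its two special cases below, this turns every cardinality of the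
    statement into a sum of booleans over a fixed range, where it can be
    manipulated with the big operators. *)
Lemma ncard_image (T : finType) (U : choiceType) (h : T -> U) (P : pred T)
    (A : set U) : {in P &, injective h} ->
  (forall u, A u <-> exists2 x, P x & u = h x) -> ncard A = (\sum_x P x)%N.
Proof.
move=> hI AP; rewrite (@ncardE _ _ [seq h x | x <- enum P]).
- by rewrite size_map -cardE -sum1_card big_mkcond.
- by rewrite map_inj_in_uniq ?enum_uniq // => x y; rewrite !mem_enum; exact: hI.
- move=> u; rewrite AP; split=> [[x Px ->]|/mapP[x]].
    by apply: map_f; rewrite mem_enum.
  by rewrite mem_enum => Px ->; exists x.
Qed.

Lemma ncard_row (p : nat) (U : choiceType) (h : nat -> U) (P : nat -> bool)
    (A : set U) :
  (forall i j, (i < p)%N -> (j < p)%N -> h i = h j -> i = j) ->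
  (forall u, A u <-> exists i, [/\ (i < p)%N, P i & u = h i]) ->
  ncard A = (\sum_(i < p) P i)%N.
Proof.
move=> hI AP; apply: (@ncard_image _ _ (fun i : 'I_p => h i)) => [i j _ _ e|u].
  by apply: val_inj; apply: hI e.
rewrite AP; split=> [[i [ip Pi ->]]|[i Pi ->]]; first by exists (Ordinal ip).
by exists i.
Qed.

Lemma ncard_grid (p q : nat) (U : choiceType) (h : nat -> nat -> U)
    (P : nat -> nat -> bool) (A : set U) :
  (forall k i k' i', (k < p)%N -> (k' < p)%N ->
    h k i = h k' i' -> k = k' /\ i = i') ->
  (forall u, A u <-> exists k i, [/\ (k < p)%N, (i < q)%N, P k i & u = h k i]) ->
  ncard A = (\sum_(k < p) \sum_(i < q) P k i)%N.
Proof.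
move=> hI AP; rewrite pair_big /=.
apply: (@ncard_image _ _ (fun x : 'I_p * 'I_q => h x.1 x.2)).
  move=> [k i] [k' i'] _ _ /= /hI[] // ek ei.
  by congr pair; exact: val_inj.
move=> u; rewrite AP; split=> [[k [i [kp iq Pki ->]]]|[[k i] Pki ->]].
  by exists (Ordinal kp, Ordinal iq).
by exists k, i.
Qed.

Lemma ncard_le (T : choiceType) (A B : set T) : finite_set B -> A `<=` B ->
  (ncard A <= ncard B)%N.
Proof.
move=> fB AB; rewrite /ncard; apply: fsubset_leq_card.
by rewrite -fset_set_sub //; exact: sub_finite_set AB fB.
Qed.

Lemma threshold (P : nat -> Prop) (M : nat) :
  (forall i, P i.+1 -> P i) -> ~ P M -> exists h, forall i, P i <-> (i < h)%N.
Proof.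
move=> down nP.
have ex : exists i, ~~ `[< P i >] by exists M; apply/asboolP.
case: (ex_minnP ex) => h /asboolP nh min; exists h => i; split=> [Pi|ih].
  rewrite ltnNge; apply/negP => hi; apply: nh.
  by rewrite -(subnK hi) in Pi; elim: (i - h)%N Pi => // d IH /down.
apply: contrapT => nPi; have := min i; move=> /(_ (introN (asboolP _) nPi)); lia.
Qed.

Lemma box_inj (k i k' i' : nat) : (i.+1, k.+1) = (i'.+1, k'.+1) :> box ->
  k = k' /\ i = i'.
Proof. by case. Qed.

(** * The box statistics of a partition inside tau *)

Section LatticePoints.
Variables (m n : nat) (l : int).

(** The position of the box in column [i] and row [j], both counted from 0. It is
    [gamma] shifted so that the boxes of [tau] are those at [n + m] or above. *)
Definition pt (i : int) (j : nat) : int := l - n%:Z * i - m%:Z * j%:Z.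

(** The position of the last box of row [j], which for an empty row is the
    (virtual) box in column -1. *)
Definition rowend (f : nat -> nat) (j : nat) : int := pt (f j)%:Z j + n%:Z.

(** The dinv condition on arm [A] and leg [L], cleared of denominators. *)
Definition balanced (A L : nat) : bool :=
  (m * L < n * A.+1)%N && (n * A <= m * L.+1)%N.

Definition legf (f : nat -> nat) (i j : nat) : nat :=
  (\sum_(k < n) ((j < k) && (i < f k)))%N.

Definition dinvf (f : nat -> nat) : nat :=
  (\sum_(j < n) \sum_(i < f j) balanced (f j - i.+1) (legf f i j))%N.

Definition intau (i j : nat) : bool := (n + m)%N%:Z <= pt i%:Z j.

(** Here, as in the double sums, the row [k] comes before the column [i]. *)
Definition outbox (f : nat -> nat) (k i : nat) : bool :=
  intau i k && (f k <= i)%N.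

Definition codinvf (f : nat -> nat) : nat :=
  (\sum_(j < n) \sum_(k < n) \sum_(i < m)
    (outbox f k i && (0 <= pt i%:Z k - rowend f j < m%:Z)%R))%N.

Hypotheses (m0 : (0 < m)%N) (n0 : (0 < n)%N) (cmn : coprime m n).
Hypothesis (lmn : 0 < l < (m * n)%N%:Z).

(** The box in column [a] and row [Y] is added to [f], the rows above [Y] being
    empty. Restricting to the topmost row makes all the columns to the left of the
    new box end in row [Y], so that every leg that matters is explicit. *)
Section AddBox.
Variables (f f' : nat -> nat) (a Y : nat).
Hypotheses (fY : f Y = a) (f'Y : f' Y = a.+1)
  (f'f : forall j, j <> Y -> f' j = f j)
  (fhi : forall j, (Y < j)%N -> f j = 0%N)
  (flo : forall j, (j < Y)%N -> (a < f j)%N)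
  (fm : forall j, (f j <= m)%N)
  (tauY : intau a Y) (ltYn : (Y < n)%N).

Let K := pt a%:Z Y.

(** All legs in row [Y] are 0, so this row contributes the number of arms [s]
    with [n * s <= m], and lengthening it adds the arm [a]. In a row [j < Y] only
    the box in column [a] is affected: its leg grows from [Y - j - 1] to
    [Y - j]. *)
Lemma dinvf_add :
  (dinvf f' + \sum_(j < n) ((j < Y) && balanced (f j - a.+1) (Y - j.+1)) =
   dinvf f + (n * a <= m) +
   \sum_(j < n) ((j < Y) && balanced (f j - a.+1) (Y - j)))%N.
Proof.
have eqleg (i j : nat) : i <> a -> legf f' i j = legf f i j.
  move=> ia; apply: eq_bigr => k _; case: (eqVneq (k : nat) Y) => [->|/eqP kY].
    by rewrite fY f'Y; lia.
  by rewrite f'f.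
have lega (j : nat) : legf f a j = (Y - j.+1)%N.
  rewrite -(@sum_between n j Y) ?(ltnW ltYn) //; apply: eq_bigr => k _.
  case: (ltngtP k Y) => [/flo->|/fhi->|->] //; rewrite fY; lia.
have leg'a (j : nat) : legf f' a j = (Y - j)%N.
  rewrite -subSS -(@sum_between n j Y.+1) //; apply: eq_bigr => k _.
  case: (eqVneq (k : nat) Y) => [->|/eqP kY]; first by rewrite f'Y; lia.
  rewrite f'f //; case: (ltngtP k Y) => [/[dup] /flo->|/[dup] /fhi->|] //; lia.
have legY (i : nat) : legf f i Y = 0%N.
  rewrite /legf big1 // => k _; case: ltnP => // /fhi ->; lia.
have leg'Y (i : nat) : legf f' i Y = 0%N.
  rewrite /legf big1 // => k _; case: ltnP => // kY; rewrite f'f ?fhi; lia.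
have -> : ((n * a <= m)%N : nat) =
    (\sum_(j < n) ((j == Y :> nat) && (n * a <= m)))%N.
  rewrite (bigD1 (Ordinal ltYn)) //= eqxx big1 ?addn0 // => j.
  by rewrite -val_eqE /= => /negPf ->.
rewrite -!big_split /=; apply: eq_bigr => j _.
case: (ltngtP j Y) => [jY|jY|->] /=.
- have jneq : (j : nat) <> Y by lia.
  rewrite addn0 f'f // (bigD1 (Ordinal (flo jY))) //=.
  rewrite [in RHS](bigD1 (Ordinal (flo jY))) //= leg'a lega.
  rewrite addnAC [RHS]addnAC [X in (X + _)%N]addnC; congr addn.
  apply: eq_bigr => i /eqP ia; rewrite eqleg // => e.
  by apply: ia; apply: val_inj.
- by rewrite !addn0 f'f ?fhi // ?big_ord0; lia.
- rewrite !addn0 f'Y fY.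
  under eq_bigr do rewrite leg'Y.
  under [in RHS]eq_bigr do rewrite legY.
  rewrite (reindex_inj rev_ord_inj) [in RHS](reindex_inj rev_ord_inj) /=.
  have E N : (\sum_(i < N) balanced (N - (N - i.+1).+1) 0 =
              \sum_(i < N) balanced i 0)%N.
    by apply: eq_bigr => i _; congr (nat_of_bool (balanced _ _)); have := ltn_ord i; lia.
  rewrite !E big_ord_recr /=; congr addn.
  by rewrite /balanced muln0 muln1 muln_gt0 n0.
Qed.

Lemma rowend_gap (j : nat) : rowend f j - K =
  n%:Z - n%:Z * ((f j)%:Z - a%:Z) + m%:Z * (Y%:Z - j%:Z).
Proof. rewrite /rowend /K /pt; lia. Qed.

(** The new box leaves the windows of the rows other than [Y]. The window of row
    [Y] moves down by [n]; translating each row by one column matches the boxes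
    in the old window with those in the new one, except that the first box outside
    [f] in row [k] may enter, which happens when [rowend f k - K] lies between [n]
    and [n + m - 1]. The summand 1 is the new box, which is lost from its own
    window. *)
Lemma codinvf_add :
  (codinvf f' + \sum_(j < n) ((j != Y :> nat) && (0 <= K - rowend f j < m%:Z)%R)
    + 1 = codinvf f +
   \sum_(j < n) (n%:Z <= rowend f j - K < (n + m)%N%:Z)%R)%N.
Proof.
have ltam : (a < m)%N.
  by move: tauY lmn; rewrite /intau /pt; nia.
have KE : rowend f' Y = K by rewrite /rowend /K f'Y /pt; lia.
have K'E : rowend f Y = K + n%:Z by rewrite /rowend /K fY /pt; lia.
(* f and f' have the same outer boxes, apart from the new one at K *)
have drop (P : int -> bool) :
   (\sum_(k < n) \sum_(i < m) (outbox f k i && P (pt i%:Z k)) =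
    \sum_(k < n) \sum_(i < m) (outbox f' k i && P (pt i%:Z k)) + P K)%N.
  rewrite -(@sum_single n m Y a (fun k i => P (pt i%:Z k))) // -big_split /=.
  apply: eq_bigr => k _; rewrite -big_split /=; apply: eq_bigr => i _.
  rewrite /outbox; case: (eqVneq (k : nat) Y) => [->|/eqP kY]; last first.
    by rewrite f'f //= addn0.
  rewrite fY f'Y; case: (ltngtP a i) => [ai|ai|<-] /=; rewrite ?andbF ?addn0 //.
  by rewrite tauY.
pose g := fun k i : nat => (f k <= i)%N && (K <= pt i%:Z k < K + m%:Z).
have KY : (n + m)%N%:Z <= K by exact: tauY.
have inK i k : K <= pt i%:Z k -> intau i k by rewrite /intau; apply: le_trans.
(* the passage from the window at K to the one at K + n, row by row *)
have rows k : (\sum_(i < m) (outbox f k i && (0 <= pt i%:Z k - rowend f' Y < m%:Z)%R)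
   = \sum_(i < m) (outbox f k i && (0 <= pt i%:Z k - rowend f Y < m%:Z)%R)
     + (n%:Z <= rowend f k - K < (n + m)%N%:Z)%R)%N.
  (* column m lies outside tau; including it makes room for the translation *)
  have -> : (\sum_(i < m) (outbox f k i && (0 <= pt i%:Z k - rowend f' Y < m%:Z)%R)
     = \sum_(i < m.+1) g k i)%N.
    rewrite big_ord_recr /=.
    have -> : g k m = false.
      have mk0 : 0 <= m%:Z * k%:Z by rewrite -PoszM.
      by apply/negP => /andP[_]; rewrite /pt; move: KY lmn; clear -mk0; lia.
    rewrite addn0; apply: eq_bigr => i _; rewrite /g /outbox KE.
    case: (boolP (K <= pt i%:Z k)) => [/[dup] /inK ->|] /=; first by lia.
    by rewrite andbF; lia.
  rewrite big_ord_recl /=.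
  have -> : ((n%:Z <= rowend f k - K < (n + m)%N%:Z)%R : nat) =
     (\sum_(i < m.+1) ((i == f k :> nat) && (K <= pt i%:Z k < K + m%:Z)%R))%N.
    have lfm : (f k < m.+1)%N by rewrite ltnS.
    rewrite (bigD1 (Ordinal lfm)) //= eqxx big1 ?addn0 /=; last first.
      by move=> i; rewrite -val_eqE /= => /negPf ->.
    by rewrite /rowend /pt; lia.
  rewrite big_ord_recl /= [RHS]addnCA; congr addn.
    by rewrite /g; lia.
  rewrite -big_split /=; apply: eq_bigr => i _; rewrite /bump /= /g /outbox K'E.
  have -> : pt (1 + i)%N%:Z k = pt i%:Z k - n%:Z by rewrite /pt; lia.
  case: (boolP (K <= pt i%:Z k)) => [/[dup] /inK ->|] /=; last by lia.
  by lia.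
rewrite /codinvf (bigD1 (Ordinal ltYn)) //= [in RHS](bigD1 (Ordinal ltYn)) //=.
rewrite [X in (_ + X + 1)%N](bigD1 (Ordinal ltYn)) //= eqxx add0n.
have := drop (fun z => 0 <= z - rowend f' Y < m%:Z)%R.
rewrite (eq_bigr _ (fun (k : 'I_n) _ => rows k)) big_split /= KE subrr lexx => dropY.
have -> : (\sum_(j < n | j != Ordinal ltYn) \sum_(k < n) \sum_(i < m)
     (outbox f k i && (0 <= pt i%:Z k - rowend f j < m%:Z)%R) =
   \sum_(j < n | j != Ordinal ltYn) \sum_(k < n) \sum_(i < m)
     (outbox f' k i && (0 <= pt i%:Z k - rowend f' j < m%:Z)%R) +
   \sum_(j < n | j != Ordinal ltYn)
     ((j != Y :> nat) && (0 <= K - rowend f j < m%:Z)%R))%N.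
  rewrite -big_split /=; apply: eq_bigr => j; rewrite -val_eqE /= => jY.
  by rewrite (drop (fun z => 0 <= z - rowend f j < m%:Z)%R) jY /rowend f'f //; apply/eqP.
have m1 : (0 < m%:Z)%R = true by lia.
have arith (A B C D E : nat) : (A + E = B + 1 -> B + C + D + 1 = A + (C + D) + E)%N.
  by lia.
by move: dropY; rewrite m1; apply: arith.
Qed.

(** Let [r] be [rowend f j - K]. For [j < Y] the four conditions on row [j] say
    that [r] lies in [-m, n), [0, n + m), (-m, 0] and [n, n + m), with signs that
    cancel except at [r = -m] and [r = 0]; there [r + m] or [r] would be a
    vanishing combination of [m] and [n] that [coprime_mul_eq] forbids. For
    [j > Y] the ends of the empty rows decrease in steps of [m], so that each of
    the two windows of length [m] is met at most once: the one at (-m, 0]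
    certainly, the one at [n, n + m) if and only if [m <= n * a]. This balances
    the term [n * a <= m] of [dinvf_add], equality being excluded. *)
Lemma dinvf_codinvf_add :
  (dinvf f' + codinvf f' = dinvf f + codinvf f)%N.
Proof.
(* sum_window for the rows above Y *)
have winY N p A c : N = (Y.+1 + p)%N -> (\sum_(j < N) ((Y < j)%N &&
    (A - m%:Z * (j%:Z - Y%:Z) <= c < A - m%:Z * (j%:Z - Y%:Z) + m%:Z)%R) +
    (c < A - m%:Z * (N%:Z - Y%:Z - 1))%R = (c < A)%R)%N.
  move=> ->; rewrite -[RHS](sum_window m A c p) big_split_ord /= big1 ?add0n; last first.
    by move=> j _; have := ltn_ord j; lia.
  congr addn; last by congr (nat_of_bool (_ < _ - _ * _)); lia.
  apply: eq_bigr => s _; congr nat_of_bool.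
  have -> : (Y < Y.+1 + s)%N by lia.
  have -> : (Y.+1 + s)%N%:Z - Y%:Z = s.+1%:Z by lia.
  by have -> : A - m%:Z * s.+1%:Z + m%:Z = A - m%:Z * s%:Z by lia.
have tauZ : n%:Z * a%:Z + m%:Z * Y%:Z + n%:Z + m%:Z < m%:Z * n%:Z.
  by move: tauY lmn; rewrite /intau /pt; lia.
have ltY1n : (Y.+1 < n)%N.
  rewrite -(ltn_pmul2l m0); have : 0 <= n%:Z * a%:Z by rewrite -PoszM.
  by move: tauZ; lia.
have H1 := dinvf_add; have H2 := codinvf_add.
have nY : n = (Y.+1 + (n - Y.+1))%N by rewrite subnKC.
(* x counts the rows above Y with r in [n, n + m), y those with r in (-m, 0] *)
have := winY n _ ((n * a)%N%:Z - m%:Z) (-1) nY.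
have -> : (-1 < (n * a)%N%:Z - m%:Z - m%:Z * (n%:Z - Y%:Z - 1)) = false by lia.
have := winY n _ (n%:Z + (n * a)%N%:Z) 0 nY.
have -> : (0 < n%:Z + (n * a)%N%:Z - m%:Z * (n%:Z - Y%:Z - 1)) = false by lia.
have -> : (0 < n%:Z + (n * a)%N%:Z) = true by lia.
set y := (\sum_(j < n) _)%N => Hy; set x := (\sum_(j < n) _)%N => Hx.
have Hd : (\sum_(j < n) (j == Y :> nat) = 1)%N.
  rewrite (bigD1 (Ordinal ltYn)) //= eqxx big1 // => j.
  by rewrite -val_eqE /= => /negPf ->.
have H3 : (\sum_(j < n) ((j < Y) && balanced (f j - a.+1) (Y - j)) +
    \sum_(j < n) (n%:Z <= rowend f j - K < (n + m)%N%:Z)%R + y =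
    \sum_(j < n) ((j < Y) && balanced (f j - a.+1) (Y - j.+1)) +
    \sum_(j < n) ((j != Y :> nat) && (0 <= K - rowend f j < m%:Z)%R) +
    \sum_(j < n) (j == Y :> nat) + x)%N.
  rewrite /x /y -!big_split /=; apply: eq_bigr => j _.
  have rK := rowend_gap j.
  case: (ltngtP j Y) => [jY|jY|jY] /=.
  - have [L YL] : exists L, Y = (j + L.+1)%N by exists (Y - j.+1)%N; lia.
    have [A fA] : exists A, f j = (a.+1 + A)%N.
      by exists (f j - a.+1)%N; have := flo jY; lia.
    have -> : (f j - a.+1 = A)%N by lia.
    have -> : (Y - j = L.+1)%N by lia.
    have -> : (Y - j.+1 = L)%N by lia.
    have d1 : (n * A <> m * L.+1)%N.
      by move=> /(coprime_mul_eq cmn) e; suff: L.+1 = 0%N by []; apply: e; lia.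
    have d2 : (n * A <> m * L.+2)%N.
      by move=> /(coprime_mul_eq cmn) e; suff: L.+2 = 0%N by []; apply: e; lia.
    have {}rK : rowend f j - K = m%:Z * L.+1%:Z - n%:Z * A%:Z.
      by rewrite rK fA YL; lia.
    have -> : K - rowend f j = n%:Z * A%:Z - m%:Z * L.+1%:Z by rewrite -[LHS]opprB rK; lia.
    rewrite rK /balanced; lia.
  - have {}rK : rowend f j - K = n%:Z + (n * a)%N%:Z - m%:Z * (j%:Z - Y%:Z).
      by rewrite rK fhi //; lia.
    have -> : K - rowend f j = - (n%:Z + (n * a)%N%:Z - m%:Z * (j%:Z - Y%:Z)).
      by rewrite -[LHS]opprB rK.
    rewrite rK; lia.
  - have -> : rowend f j - K = n%:Z by rewrite rK jY fY; lia.
    lia.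
have arith (d d' c c' u v w E dl x' y' b b' : nat) :
    (d' + u = d + b + v -> c' + w + 1 = c + E -> v + E + y' = u + w + dl + x' ->
     dl = 1 -> y' + 0 = 1 -> x' + 0 = b' -> b + b' = 1 -> d' + c' = d + c)%N by lia.
apply: (arith _ _ _ _ _ _ _ _ _ _ _ _ _ H1 H2 H3 Hd Hy Hx).
(* n > 1 is coprime to m *)
have na_m : (n * a <> m)%N.
  move=> e; suff : 1%N = 0%N by []; apply: (@coprime_mul_eq m n a) => //; last by lia.
  by rewrite muln1.
by move: na_m; lia.
Qed.
End AddBox.

Lemma intau_bounds (i j : nat) : intau i j -> (i.+1 < m)%N /\ (j.+1 < n)%N.
Proof.
rewrite /intau /pt => t.
have im0 : 0 <= n%:Z * i%:Z by rewrite -PoszM.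
have jm0 : 0 <= m%:Z * j%:Z by rewrite -PoszM.
by split; [rewrite -(ltn_pmul2l n0) | rewrite -(ltn_pmul2l m0)]; lia.
Qed.

(** The ends of the [n] empty rows are [m] apart and their windows have length
    [m], so the windows tile the interval that contains the boxes of [tau]. *)
Lemma codinvf0 :
  (codinvf (fun=> 0) = \sum_(k < n) \sum_(i < m) intau i k)%N.
Proof.
rewrite /codinvf exchange_big /=; apply: eq_bigr => k _.
rewrite exchange_big /=; apply: eq_bigr => i _.
rewrite /outbox leq0n andbT; case: (boolP (intau i k)) => [t|_] /=; last exact: big1.
have := sum_window m m%:Z (- (n%:Z * i%:Z + n%:Z + m%:Z * k%:Z)) n.
have im0 : 0 <= n%:Z * i%:Z by rewrite -PoszM.
have km0 : 0 <= m%:Z * k%:Z by rewrite -PoszM.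
have -> : (- (n%:Z * i%:Z + n%:Z + m%:Z * k%:Z) < m%:Z) = true by lia.
have -> : (- (n%:Z * i%:Z + n%:Z + m%:Z * k%:Z) < m%:Z - m%:Z * n%:Z) = false.
  by move: t lmn; rewrite /intau /pt; lia.
rewrite addn0 => E; transitivity (nat_of_bool true) => //; rewrite -E.
apply: eq_bigr => j _; congr nat_of_bool.
by rewrite /rowend /pt; lia.
Qed.

Lemma dinvf0 : dinvf (fun=> 0%N) = 0%N.
Proof. by rewrite /dinvf big1 // => j _; rewrite big_ord0. Qed.

(** A last row of length 0 is allowed so that the induction can start a new
    row; [nth] does not see it. *)
Lemma dinvf_codinvf (la : seq nat) : sorted geq la ->
    (forall j i, (i < nth 0%N la j)%N -> intau i j) ->
  (dinvf (nth 0%N la) + codinvf (nth 0%N la) =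
   \sum_(k < n) \sum_(i < m) intau i k)%N.
Proof.
elim/last_ind: la => [|la x IH] srt tau.
  have -> : nth 0%N [::] = (fun=> 0%N) by apply/funext => j; rewrite nth_nil.
  by rewrite dinvf0 codinvf0.
elim: x srt tau => [|a IHa] srt tau.
  have -> : nth 0%N (rcons la 0%N) = nth 0%N la.
    apply/funext => j; rewrite nth_rcons; case: ltngtP => // [h|->].
      by rewrite nth_default // ltnW.
    by rewrite nth_default.
  apply: IH; first by move: srt; rewrite -cats1 => /cat_sorted2[].
  move=> j i; case: (ltnP j (size la)) => [jl lt|jl]; last by rewrite nth_default.
  by apply: tau; rewrite nth_rcons jl.
have nY : nth 0%N (rcons la a.+1) (size la) = a.+1 by rewrite nth_rcons ltnn eqxx.
have tY : intau a (size la) by apply: tau; rewrite nY.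
have le_a j : (nth 0%N (rcons la a) j <= nth 0%N (rcons la a.+1) j)%N.
  by rewrite !nth_rcons; case: ltngtP.
rewrite (@dinvf_codinvf_add (nth 0%N (rcons la a)) _ a (size la)) //.
- apply: IHa => [|j i lt]; last by apply: tau; apply: leq_trans lt (le_a j).
  move: srt; case: (la) => // y s; rewrite /= !rcons_path => /andP[-> /=].
  by move=> h; apply: leq_trans h.
- by rewrite nth_rcons ltnn eqxx.
- by move=> j /eqP jY; rewrite !nth_rcons (negPf jY).
- by move=> j Yj; rewrite nth_rcons; case: ltngtP Yj.
- by move=> j jY; have := nth_sorted_geq srt (ltnW jY); rewrite nY !nth_rcons jY.
- move=> j; case: (posnP (nth 0%N (rcons la a) j)) => [->//|h].
  have /tau/intau_bounds[] : ((nth 0%N (rcons la a) j).-1 < nth 0%N (rcons la a.+1) j)%N.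
    by have := le_a j; lia.
  by lia.
- by have /intau_bounds[_ /ltnW] := tY.
Qed.

(** * Subsets of the integers as partitions *)

Lemma pt_inj (i i' : int) (j j' : nat) : (j < n)%N -> (j' < n)%N ->
  pt i j = pt i' j' -> i = i' /\ j = j'.
Proof.
wlog le_jj : i i' j j' / (j <= j')%N.
  move=> W hj hj' e; case: (leqP j j') => [|/ltnW] h; first exact: W.
  by have [] := W i' i j' j h hj' hj (esym e).
move=> hj hj' e.
have ed : n%:Z * (i - i') = m%:Z * (j' - j)%N%:Z.
  by move: e; rewrite /pt -(subzn le_jj); lia.
have di : 0 <= i - i'.
  by rewrite -(@pmulr_rge0 _ n%:Z) // ed -PoszM.
have ej : (j' - j)%N = 0%N.
  apply: (@coprime_mul_eq m n `|i - i'|%N) => //; last by lia.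
  by apply/eqP; rewrite -eqz_nat !PoszM gez0_abs // ed.
move/eqP: ed; rewrite ej mulr0 mulf_eq0; lia.
Qed.

Lemma pt_surj (k : int) : exists i j, (j < n)%N /\ k = pt i j.
Proof.
have /coprimezP[[u v] /= uv] : coprimez m%:Z n%:Z by rewrite /coprimez /gcdz.
have n0z : n%:Z != 0 by lia.
set c := l - k; set r := (c * u %% n)%Z.
have r0 : 0 <= r by exact: modz_ge0.
have rn : r < n%:Z by apply: ltz_pmod; lia.
exists ((c * u %/ n)%Z * m%:Z + c * v), `|r|%N; split; first by lia.
have cE : c = c * u * m%:Z + c * v * n%:Z by rewrite -!mulrA -mulrDr uv mulr1.
rewrite [in c * u * _](divz_eq (c * u) n) -/r in cE.
rewrite /pt gez0_abs //; have : k = l - c by rewrite /c; lia.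
by move: cE; clearbody r c; lia.
Qed.

Lemma ptBn (i : int) (j : nat) : pt i j - n%:Z = pt (i + 1) j.
Proof. by rewrite /pt; lia. Qed.

Lemma ptDn (i : int) (j : nat) : pt i j + n%:Z = pt (i - 1) j.
Proof. by rewrite /pt; lia. Qed.

Lemma ptDm (i : int) (j : nat) : pt i j.+1 + m%:Z = pt i j.
Proof. by rewrite /pt; lia. Qed.

Lemma ptDm0 (i : int) : pt i 0 + m%:Z = pt (i - m%:Z) n.-1.
Proof. by rewrite /pt; case: n n0 => //= n' _; lia. Qed.

(** The shift between [pt] and [Gamma] is the one in the definition of [w]. A
    combination [n * x + m * y] has the coordinate [i = -1 - x - m * (y %/ n)],
    obtained by reducing [y] modulo [n]. *)
Lemma Gamma_pt (i : int) (j : nat) : (j < n)%N ->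
  Gamma m n (pt i j + (m * n)%N%:Z - l - (n + m)%N%:Z) <-> i < 0.
Proof.
move=> hj; split=> [[x [y e]]|i0]; last first.
  exists `|(i + 1)%R|%N, (n - j.+1)%N.
  have -> : (n * `|(i + 1)%R| + m * (n - j.+1))%N%:Z =
      n%:Z * (- (i + 1)) + m%:Z * (n%:Z - j.+1%:Z).
    by rewrite PoszD !PoszM subzn // lez0_abs; lia.
  by rewrite /pt; lia.
have yE := divn_eq y n; set q := (y %/ n)%N in yE; set s := (y %% n)%N in yE.
have sn : (s < n)%N by rewrite ltn_mod.
have e' : pt i j = pt (- 1 - x%:Z - m%:Z * q%:Z) (n - s.+1)%N.
  have -> : pt i j = l + (n + m)%N%:Z - (m * n)%N%:Z + (n * x + m * y)%N%:Z.
    by rewrite -e; lia.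
  by rewrite /pt -(subzn sn) yE; lia.
have [|-> _] := pt_inj hj _ e'; first by lia.
have : 0 <= m%:Z * q%:Z by rewrite -PoszM.
by lia.
Qed.

(** The subset attached to a partition with row lengths [f]: the boxes of the
    partition, together with the nonnegative integers to the left of the first
    column. *)
Definition Dset (f : nat -> nat) : set int :=
  [set k | 0 <= k /\ exists i j, [/\ (j < n)%N, k = pt i j & i < (f j)%:Z]].

Lemma Dset_pt (f : nat -> nat) (i : int) (j : nat) : (j < n)%N ->
  Dset f (pt i j) <-> 0 <= pt i j /\ i < (f j)%:Z.
Proof.
move=> hj; split=> [[p0 [i' [j' [hj' e lt]]]]|[p0 lt]].
  by have [-> ->] := pt_inj hj hj' e; split=> //; rewrite -e.
by split=> //; exists i, j.
Qed.

(** Membership in [Dyck] in terms of 0-based row lengths. *)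
Lemma DyckP (la : seq nat) : Dyck m n l la <->
  [/\ sorted geq la, 0%N \notin la &
      forall j i, (i < nth 0%N la j)%N -> intau i j].
Proof.
rewrite /Dyck /is_partition /=; split=> [[/andP[-> ->] sub]|[-> -> h]].
  split=> // j i ij; have /sub : boxes la (i.+1, j.+1) by [].
  by case=> /= _ _; rewrite /intau /pt; lia.
split=> // -[[|i] [|j]] [] //= _ ij; split=> //=.
by have := h j i ij; rewrite /intau /pt; lia.
Qed.

Lemma tnth_w (i : 'I_(m + n)) : tnth (w m n l) i =
  `[< Gamma m n ((i : nat)%:Z + (m * n)%N%:Z - l - (n + m)%N%:Z) >].
Proof. by rewrite /w tnth_mktuple. Qed.

Lemma Inv_wP (D : set int) : Inv_w (w m n l) D <->
  Defs.Inv m n D /\ forall i j, (j < n)%N -> 0 <= pt i j < (m + n)%N%:Z ->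
    (D (pt i j) <-> i < 0).
Proof.
rewrite /Inv_w /=; split=> -[ID h]; split=> //.
  move=> i j hj /andP[p0 pmn].
  have pE : pt i j = `|pt i j|%N%:Z by rewrite gez0_abs.
  have lt : (`|pt i j|%N < m + n)%N by lia.
  rewrite -(Gamma_pt i hj) {1}pE; have := h (Ordinal lt).
  rewrite tnth_w /= -pE => ->; split=> [/asboolP|] //.
  by move=> g; apply/asboolP.
move=> k; have [i [j [hj e]]] := pt_surj (k : nat)%:Z.
rewrite tnth_w e; have := ltn_ord k => kl.
rewrite h //; last by rewrite -e; lia.
by rewrite -(Gamma_pt i hj); split=> [g|/asboolP//]; apply/asboolP.
Qed.

(** Adding [n] moves one column to the left and adding [m] one row down, which a
    partition allows. From row 0 adding [m] leads to row [n - 1], but [m] columns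
    to the left and hence out of [tau]. *)
Lemma Dset_Inv_w (la : seq nat) : Dyck m n l la ->
  Inv_w (w m n l) (Dset (nth 0%N la)).
Proof.
move=> /DyckP[srt _ tau]; apply/Inv_wP; split; first split.
- by move=> k [].
- move=> k [k0 [i [j [hj e lt]]]].
  have k0' : 0 <= k + m%:Z by lia.
  case: j => [|j] in hj e lt *; rewrite e in k0' *.
    rewrite ptDm0 in k0' *; apply/Dset_pt; first by rewrite prednK.
    split=> //; case: (posnP (nth 0%N la 0)) => [f0|f0]; first by lia.
    have /tau/intau_bounds[] : ((nth 0%N la 0).-1 < nth 0%N la 0)%N by lia.
    by lia.
  rewrite ptDm in k0' *; apply/Dset_pt; first by lia.
  by split=> //; have := nth_sorted_geq srt (leqnSn j); lia.
- move=> k [k0 [i [j [hj e lt]]]]; rewrite e ptDn; apply/Dset_pt => //.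
  by rewrite -ptDn -e; split; lia.
move=> i j hj /andP[p0 pmn]; split=> [/Dset_pt[//|_ lt]|i0]; last first.
  by apply/Dset_pt => //; split=> //; lia.
rewrite ltNge; apply/negP => i0; have iE : i = `|i|%N%:Z by rewrite gez0_abs.
have /tau : (`|i|%N < nth 0%N la j)%N by lia.
by rewrite /intau -iE; lia.
Qed.

Lemma Dset_inj (la mu : seq nat) : Dyck m n l la -> Dyck m n l mu ->
  Dset (nth 0%N la) = Dset (nth 0%N mu) -> la = mu.
Proof.
have sub la' mu' : Dyck m n l la' -> Dset (nth 0%N la') = Dset (nth 0%N mu') ->
    forall j, (nth 0%N la' j <= nth 0%N mu' j)%N.
  move=> /DyckP[srt _ tau] e j; case E : (nth 0%N la' j) => [//|i].
  have t : intau i j by apply: tau; rewrite E.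
  have [_ /ltnW hj] := intau_bounds t.
  have : Dset (nth 0%N la') (pt i%:Z j).
    by apply/Dset_pt => //; move: t; rewrite /intau E; split; lia.
  by rewrite e => /Dset_pt[] //; lia.
move=> Dla Dmu e.
have en j : nth 0%N la j = nth 0%N mu j.
  by apply/eqP; rewrite eqn_leq !sub.
move: Dla Dmu => /DyckP[_ la0 _] /DyckP[_ mu0 _].
have nz s j : 0%N \notin s -> (nth 0%N s j == 0%N) = (size s <= j)%N.
  move=> s0; case: leqP => [h|h]; first by rewrite nth_default.
  by apply: contraNF s0 => /eqP <-; exact: mem_nth.
have sz j : (size la <= j)%N = (size mu <= j)%N by rewrite -!nz // en.
apply: (@eq_from_nth _ 0%N) => //; apply/eqP.
by rewrite eqn_leq sz leqnn -sz leqnn.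
Qed.

(** In each row the boxes of [tau] that [D] contains form an initial segment, by
    closure under adding [n]; closure under adding [m] makes the lengths of these
    segments decrease. *)
Lemma Dset_surj (D : set int) : Inv_w (w m n l) D ->
  exists2 la, Dyck m n l la & Dset (nth 0%N la) = D.
Proof.
move=> /Inv_wP[[D0 Dm Dn] Dw].
have row j : exists h, forall i : nat,
    (intau i j /\ D (pt i%:Z j)) <-> (i < h)%N.
  apply: (@threshold _ m) => [i [t Di]|[/intau_bounds]]; last by lia.
  split; first by move: t; rewrite /intau /pt; lia.
  have -> : i%:Z = i.+1%:Z - 1 by lia.
  by rewrite -ptDn; exact: Dn.
have [f fP] := choice row.
have f_dec j : (f j.+1 <= f j)%N.
  rewrite leqNgt; apply/negP => /fP[t Dj].
  suff : (f j < f j)%N by rewrite ltnn.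
  apply/fP; split; first by move: t; rewrite /intau /pt; lia.
  by rewrite -ptDm; exact: Dm.
have [s sP] : exists s, forall j, (0 < f j)%N <-> (j < s)%N.
  apply: (@threshold _ n) => [j|/fP[/intau_bounds]]; last by lia.
  by move=> h; apply: leq_trans h _.
have nthf j : nth 0%N (mkseq f s) j = f j.
  case: (ltnP j s) => [js|sj]; first by rewrite nth_mkseq.
  rewrite nth_default ?size_mkseq //.
  by case: (posnP (f j)) => // /sP; rewrite ltnNge sj.
exists (mkseq f s).
  apply/DyckP; split.
  - by apply/(sortedP 0%N) => j _; rewrite !nthf; exact: f_dec.
  - apply/negP => /mapP[j]; rewrite mem_iota => /andP[_ /sP].
    by move=> + e; rewrite -e.
  - by move=> j i; rewrite nthf => /fP[].
(* A point with i < 0 at n + m or above is reached from a smaller one of this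
   kind: by adding n if i < -1, and by adding m if i = -1, because the point
   with i = -1 in the last row is below n + m. *)
have corner i j : (j < n)%N -> 0 <= pt i j -> i < 0 -> D (pt i j).
  move=> hj p0 i0; have [N] := ubnP `|pt i j|%N.
  elim: N i j hj p0 i0 => // N IH i j hj p0 i0 ltN.
  case: (ltP (pt i j) (m + n)%N%:Z) => [pmn|pmn].
    by apply/Dw => //; rewrite p0.
  case: (ltP (i + 1) 0) => [i1|i1].
    have -> : pt i j = pt (i + 1) j + n%:Z by rewrite -ptBn subrK.
    by apply: Dn; apply: IH; rewrite -?ptBn //; lia.
  have im : i = -1 by lia.
  have jn : (j.+1 < n)%N.
    rewrite ltn_neqAle hj andbT; apply/eqP => jn.
    by move: pmn lmn; rewrite im /pt -jn; lia.
  by rewrite -ptDm; apply: Dm; apply: IH => //; move: ltN p0 pmn; rewrite -(ptDm i j); lia.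
apply/seteqP; split=> k.
  have [i [j [hj ->]]] := pt_surj k => /Dset_pt[//|p0]; rewrite nthf => lt.
  case: (ltP i 0) => [i0|i0]; first exact: corner.
  have iE : i = `|i|%N%:Z by rewrite gez0_abs.
  have /fP[_] : (`|i|%N < f j)%N by lia.
  by rewrite -iE.
move=> Dk; have [i [j [hj e]]] := pt_surj k; rewrite e in Dk *.
have p0 : 0 <= pt i j := D0 _ Dk.
apply/Dset_pt => //; split=> //; rewrite nthf.
case: (ltP i 0) => [i0|i0]; first by lia.
case: (ltP (pt i j) (m + n)%N%:Z) => [pmn|pmn].
  have /Dw : 0 <= pt i j < (m + n)%N%:Z by rewrite p0.
  by move=> /(_ hj) /iffLR/(_ Dk); lia.
have iE : i = `|i|%N%:Z by rewrite gez0_abs.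
suff /fP : intau `|i|%N j /\ D (pt `|i|%N%:Z j) by lia.
by rewrite /intau -iE; split=> //; rewrite addnC.
Qed.

(** * Comparison of the statistics *)

Lemma ncard_tau : ncard (tau m n l) = (\sum_(k < n) \sum_(i < m) intau i k)%N.
Proof.
apply: (ncard_grid (h := fun k i => (i.+1, k.+1) : box)
  (P := fun k i => intau i k)) => [k i k' i' _ _ /box_inj //|].
move=> [[|i] [|k]]; split=> [[]//=|]; try by move=> [? [? []]].
  move=> _ _ h; have t : intau i k by move: h; rewrite /intau /pt; lia.
  by exists k, i; have [? ?] := intau_bounds t; split=> //; lia.
move=> [k' [i' [_ _ t [-> ->]]]]; split=> //.
by move: t; rewrite /intau /pt /=; lia.
Qed.

Section Statistics.
Variable la : seq nat.
Hypothesis Dla : Dyck m n l la.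

Local Notation f := (nth 0%N la).
Local Notation D := (Dset (nth 0%N la)).

Let srt : sorted geq la. Proof. by case/DyckP: Dla. Qed.

Let tau_la i j : (i < f j)%N -> intau i j.
Proof. by case/DyckP: Dla => _ _; exact. Qed.

Let box_bounds i j : (i < f j)%N -> (i.+1 < m)%N /\ (j.+1 < n)%N.
Proof. by move=> /tau_la /intau_bounds. Qed.

Lemma nth_le_m j : (f j <= m)%N.
Proof. by case E : (f j) => [//|i]; have [|] := @box_bounds i j; rewrite ?E //; lia. Qed.

Lemma ncard_boxes : ncard (boxes la) = (\sum_(k < n) \sum_(i < m) (i < f k))%N.
Proof.
apply: (ncard_grid (h := fun k i => (i.+1, k.+1) : box)
  (P := fun k i => (i < f k)%N)) => [k i k' i' _ _ /box_inj //|].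
move=> [[|i] [|k]]; split=> [[]//=|]; try by move=> [? [? []]].
  by move=> _ lt; exists k, i; have [? ?] := box_bounds lt; split=> //; lia.
by move=> [k' [i' [_ _ t [-> ->]]]].
Qed.

Lemma area_sum :
  area m n l la = (\sum_(k < n) \sum_(i < m) outbox f k i)%N.
Proof.
rewrite /area ncard_tau ncard_boxes.
have -> : (\sum_(k < n) \sum_(i < m) intau i k =
  \sum_(k < n) \sum_(i < m) outbox f k i +
  \sum_(k < n) \sum_(i < m) (i < f k))%N.
  rewrite -big_split; apply: eq_bigr => k _; rewrite -big_split.
  apply: eq_bigr => i _; rewrite /outbox /=.
  by case: ltnP => [/tau_la ->|] //=; rewrite andbT addn0.
by rewrite addnK.
Qed.

Lemma gaps_pt i j : (j < n)%N -> (n + m)%N%:Z <= pt i j ->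
  gaps D (pt i j) <-> (f j)%:Z <= i.
Proof.
move=> hj p0; rewrite /gaps /=; split=> [[_ nD]|lt].
  by rewrite leNgt; apply/negP => lt; apply: nD; apply/Dset_pt => //; split=> //; lia.
by split; [lia | move=> /Dset_pt[//|_]; lia].
Qed.

Lemma ncard_gaps (P : int -> bool) :
  ncard ((gaps D `&` [set k | (n + m)%N%:Z <= k]) `&` [set k | P k]) =
  (\sum_(k < n) \sum_(i < m) (outbox f k i && P (pt i%:Z k)))%N.
Proof.
apply: (ncard_grid (h := fun k i => pt i%:Z k)
  (P := fun k i => outbox f k i && P (pt i%:Z k))) => [k i k' i' hk hk'|u].
  by move=> /pt_inj[] // [->] ->.
split=> [[[g /= uge] Pu]|[k [i [hk hi /andP[/andP[t fi] Pu] ->]]]].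
  have [i [k [hk e]]] := pt_surj u; rewrite e in g uge Pu *.
  have /(gaps_pt hk uge) fi := g.
  have iE : i = `|i|%N%:Z by lia.
  rewrite iE in uge Pu fi *; exists k, `|i|%N.
  have [? ?] := intau_bounds (uge : intau _ _).
  by rewrite /outbox /intau uge Pu; split=> //; lia.
by split=> //; split=> //; apply/gaps_pt => //; lia.
Qed.

Lemma area'_sum : area' m n D = area m n l la.
Proof.
rewrite area_sum /area'.
have := ncard_gaps xpredT; under eq_bigr do under eq_bigr do rewrite andbT.
by move=> <-; congr ncard; apply/seteqP; split=> k //= [].
Qed.

(** A generator is the least element of its row in [D]. This is the end of the
    row, unless that end is negative, in which case the generator is less than
    [n]. *)
Lemma ngenP (k : int) : n%:Z <= k ->
  ngen n D k <-> exists2 j, (j < n)%N & k = rowend f j.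
Proof.
move=> nk; have [i [j [hj e]]] := pt_surj k; rewrite e in nk *.
have rE j' : rowend f j' = pt ((f j')%:Z - 1) j' by rewrite -ptDn.
rewrite /ngen /= ptBn; split=> [[/Dset_pt[//|_ lt] nD]|[j' hj' e']].
  exists j => //; rewrite rE; congr pt; apply/eqP; rewrite eq_le.
  apply/andP; split; first by lia.
  rewrite leNgt; apply/negP => lt'; apply: nD; apply/Dset_pt => //.
  by rewrite -ptBn; split; lia.
have [-> ->] := pt_inj hj hj' (etrans e' (rE _)).
split; first by apply/Dset_pt => //; rewrite -rE -e'; split; lia.
by move=> /Dset_pt[//|_]; lia.
Qed.

Lemma rowend_inj i j : (i < n)%N -> (j < n)%N ->
  rowend f i = rowend f j -> i = j.
Proof. by move=> hi hj /addIr /pt_inj[]. Qed.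

(** For [-1 <= k] the window lies above [n], where generators and row ends
    agree. *)
Lemma xi_sum (k : int) : -1 <= k -> xi m n D k =
  (\sum_(j < n) (n%:Z + k + 1 <= rowend f j <= n%:Z + k + m%:Z)%R)%N.
Proof.
move=> k1; apply: (ncard_row (h := rowend f)
  (P := fun j => n%:Z + k + 1 <= rowend f j <= n%:Z + k + m%:Z)) => [|u].
  exact: rowend_inj.
split=> [[g /= bd]|[j [hj bd ->]]].
  have /ngenP/iffLR/(_ g)[j hj e] : n%:Z <= u by lia.
  by exists j; rewrite -e.
split=> //; apply/ngenP; last by exists j.
by lia.
Qed.

Lemma xi_box_sum (b : box) (k : int) :
  k = l + (n + m)%N%:Z - n%:Z * b.1%:Z - m%:Z * b.2%:Z -> xi_box m n la b =
  (\sum_(j < n) (n%:Z + k + 1 <= rowend f j <= n%:Z + k + m%:Z)%R)%N.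
Proof.
move=> kE; apply: (ncard_row (h := fun j => (f j, j.+1) : box)
  (P := fun j => n%:Z + k + 1 <= rowend f j <= n%:Z + k + m%:Z)) => [i j _ _ [] //|u].
have gE j : gamma m n (f j, j.+1) = rowend f j - l - n%:Z - m%:Z + (m * n)%N%:Z.
  by rewrite /gamma /rowend /pt /=; lia.
have gb : gamma m n b = k - l - n%:Z - m%:Z + (m * n)%N%:Z.
  by rewrite /gamma kE; lia.
split=> [[[/= bd e]]|[j [hj bd ->]]].
  case: u bd e => u1 [//|j] /= hj ->; rewrite /part /= gE gb => bd.
  by exists j; split=> //; lia.
by split; [split=> //= | rewrite gE gb; lia].
Qed.

(** A row whose end is below [n + m] is empty, and the ends of the empty rows
    are [m] apart, while the window has length [m]. *)
Lemma xi_le1 : (xi m n D (-1) <= 1)%N.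
Proof.
rewrite xi_sum //; have := sum_window m l (-1) n.
have -> : (-1 < l) = true by lia.
move=> E; apply: (@leq_trans (\sum_(s < n)
    (l - m%:Z * s.+1%:Z <= -1 < l - m%:Z * s%:Z)%R)%N); last first.
  by rewrite -[leqRHS]/(nat_of_bool true) -E leq_addr.
apply: leq_sum => j _; case E' : (f j) => [|i].
  by rewrite /rowend /pt E'; lia.
have : intau i j by apply: tau_la; rewrite E'.
by rewrite /rowend E' /intau /pt; lia.
Qed.

(** Generators and row ends may differ below [n], but there the window ends
    before [n + m] and the contribution is 0. *)
Lemma codinv'_sum : codinv' m n D = (codinvf f)%:Z.
Proof.
rewrite /codinv'.
have -> : 'C(xi m n D (-1), 2) = 0%N by apply: bin_small; have := xi_le1; lia.
rewrite subr0; set G := fun x : int => (ncard _)%:Z.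
have GE x : G x = (\sum_(k < n) \sum_(i < m)
    (outbox f k i && (0 <= pt i%:Z k - x < m%:Z)%R))%N%:Z.
  rewrite /G -(ncard_gaps (fun z => 0 <= z - x < m%:Z)).
  congr (ncard _)%:Z; apply/seteqP; split=> k /= [? ?]; split=> //; lia.
have G0 x : x < n%:Z -> G x = 0.
  move=> xn; rewrite GE big1 // => k _; rewrite big1 // => i _.
  by rewrite /outbox /intau; lia.
rewrite -(@fsbig_widen _ _ _ _ (ngen n D `&` [set x | n%:Z <= x])); last 2 first.
- by move=> x [].
- move=> x [gx /= ngx]; apply: G0; rewrite ltNge; apply/negP => h.
  by apply: ngx.
rewrite (@reindex_fsbig _ _ _ nat _ (rowend f)
   ([set j | (j < n)%N /\ n%:Z <= rowend f j])); last first.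
  split=> [j [hj nj]|i j|x [gx nx]].
  - by split=> //; apply/ngenP => //; exists j.
  - by move=> /set_mem[hi _] /set_mem[hj _]; exact: rowend_inj.
  - by have /ngenP/iffLR/(_ gx)[j hj e] := nx; exists j => //; rewrite e in nx *; split.
rewrite (@fsbig_widen _ _ _ _ _ `I_n); last 2 first.
- by move=> j [].
- move=> j [/= hj nj]; apply: G0; rewrite ltNge; apply/negP => h; exact: nj.
rewrite -fsbig_ord -[RHS]natz /codinvf natr_sum.
by apply: eq_bigr => j _; rewrite natz; exact: GE.
Qed.

Lemma arm_nth i j : (i < f j)%N -> arm la (i.+1, j.+1) = (f j - i.+1)%N.
Proof.
move=> lt; rewrite -(@sum_between m i (f j) (nth_le_m j)) /arm.
apply: (ncard_row (h := fun i' => (i'.+1, j.+1) : box)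
  (P := fun i' => (i < i')%N && (i' < f j)%N)) => [i1 i2 _ _ []//|].
move=> [[|i'] j']; split=> [[[//= _ lt'] /= ej ii]|[i1 [h /andP[h1 h2] [-> ->]]]//].
  rewrite ej /part /= in lt' *; exists i'; split=> //; last by lia.
  exact: leq_trans lt' (nth_le_m j).
Qed.

Lemma leg_nth i j : leg la (i.+1, j.+1) = legf f i j.
Proof.
rewrite /leg /legf; apply: (ncard_row (h := fun k => (i.+1, k.+1) : box)
  (P := fun k => (j < k)%N && (i < f k)%N)) => [i1 i2 _ _ []//|].
move=> [i' [|j']]; split=> [[[//= _ lt'] /= ej ii]|[i1 [h /andP[h1 h2] [-> ->]]]//].
rewrite ej /part /= in lt' *; exists j'; split=> //; last by lia.
by have [_ /ltnW] := @box_bounds i j' lt'.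
Qed.

Lemma balancedP (A L : nat) : balanced A L <->
  L%:R / A.+1%:R < n%:R / m%:R :> rat /\
  (A = 0%N \/ n%:R / m%:R <= L.+1%:R / A%:R :> rat).
Proof.
have mR : (0 : rat) < m%:R by rewrite ltr0n.
have E1 : (L%:R / A.+1%:R < n%:R / m%:R :> rat) = (m * L < n * A.+1)%N.
  rewrite ltr_pdivrMr ?ltr0n // mulrAC ltr_pdivlMr // -!natrM ltr_nat.
  by rewrite (mulnC L).
have E2 : (0 < A)%N ->
    (n%:R / m%:R <= L.+1%:R / A%:R :> rat) = (n * A <= m * L.+1)%N.
  move=> A0; rewrite ler_pdivlMr ?ltr0n // mulrAC ler_pdivrMr // -!natrM ler_nat.
  by rewrite (mulnC L.+1).
rewrite E1 /balanced; case: (posnP A) => [->|A0].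
  by rewrite muln0 andbT; split=> [->|[]//]; split=> //; left.
rewrite E2 //; split=> [/andP[-> ->]|[-> [|->]//]]; first by split=> //; right.
by lia.
Qed.

Lemma dinv_sum : dinv m n la = dinvf f.
Proof.
transitivity (\sum_(k < n) \sum_(i < m)
    ((i < f k) && balanced (f k - i.+1) (legf f i k)))%N.
  apply: (ncard_grid (h := fun k i => (i.+1, k.+1) : box)
    (P := fun k i => (i < f k) && balanced (f k - i.+1) (legf f i k))%N).
    by move=> k i k' i' _ _ /box_inj.
  move=> [[|i] [|k]]; split=> [[[//= _ ik]]|]; try by move=> [? [? []]].
    rewrite /part /= in ik; rewrite leg_nth arm_nth // => hlt hle.
    have [? ?] := box_bounds ik.
    exists k, i; split=> //; [by lia|by lia|].
    by rewrite ik; apply/balancedP; split.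
  move=> [k' [i' [_ _ /andP[ik /balancedP[hlt hle]] [-> ->]]]].
  by rewrite /= leg_nth arm_nth.
apply: eq_bigr => k _.
rewrite (big_ord_widen m (fun i => nat_of_bool
  (balanced (f k - i.+1) (legf f i k))) (nth_le_m k)) [RHS]big_mkcond.
by apply: eq_bigr => i _; case: (i < f k)%N.
Qed.

Definition box_pt (b : box) : int :=
  l + (n + m)%N%:Z - n%:Z * b.1%:Z - m%:Z * b.2%:Z.

Lemma box_ptE i j : box_pt (i.+1, j.+1) = pt i%:Z j.
Proof. by rewrite /box_pt /pt /=; lia. Qed.

(** An addable box continues a row that is the first one or shorter than the row
    below it. *)
Lemma ABP (b : box) : AB la b <->
  exists2 j, b = ((f j).+1, j.+1) & j = 0%N \/ (f j < f j.-1)%N.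
Proof.
have nz k : (k < size la)%N -> (0 < f k)%N.
  move=> ks; rewrite lt0n; have [_ la0 _] := (DyckP la).1 Dla.
  by apply: contraNneq la0 => <-; exact: mem_nth.
split=> [[b1 b2 nb [mu /andP[srt' _] bE]]|[j -> jP]].
  case: b b1 b2 nb bE => [[//|i] [//|j]] /= _ _ nb bE.
  have mem u : boxes mu u <-> boxes la u \/ u = (i.+1, j.+1) by rewrite bE.
  have ij : (i < nth 0%N mu j)%N by have [_] := (mem (i.+1, j.+1)).2 (or_intror erefl).
  have fi : (f j <= i)%N by rewrite leqNgt; apply/negP => h; apply: nb.
  have iE : i = f j.
    apply/eqP; rewrite eqn_leq fi andbT leqNgt; apply/negP => lt.
    case: i lt ij mem {nb bE fi} => // i lt ij mem.
    have /mem[[_ /=]|[]] : boxes mu (i.+1, j.+1) by split=> //=; apply: ltnW.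
      by rewrite /part /=; lia.
    by lia.
  exists j; first by rewrite -iE.
  case: j iE ij mem {nb bE fi} => [|j] iE ij mem; first by left.
  right; rewrite -iE /=.
  have /mem[[_ /=]|[]] // : boxes mu (i.+1, j.+1).
    by split=> //=; apply: leq_trans ij (nth_sorted_geq srt' (leqnSn j)).
  by lia.
have js : (j <= size la)%N.
  case: jP => [->//|lt]; case: j lt => // j lt.
  by rewrite ltnNge; apply/negP => h; rewrite /= (nth_default _ h) in lt.
split=> //=; first by move=> [_ /=]; rewrite /part /= ltnn.
exists (incr_nth la j); last first.
  have mem i k : boxes (incr_nth la j) (i, k) <->
      boxes la (i, k) \/ (i, k) = ((f j).+1, j.+1).
    rewrite /boxes /part /= nth_incr_nth.
    case: k => [|k] /=; first by split=> [[]|[[]|[]]].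
    case: i => [|i] /=; first by split=> [[]|[[]|[]]].
    split=> [[_]|[[_ h]|[-> ->]]].
    - case: (eqVneq j k) => [->|] h; last by left.
      by move: h; rewrite add1n ltnS leq_eqVlt => /orP[/eqP ->|?]; [right|left].
    - by split=> //; apply: leq_trans h (leq_addl _ _).
    - by rewrite eqxx.
  by apply/seteqP; split=> -[i k] /mem.
apply/andP; split.
  apply/(sortedP 0%N) => k _; rewrite /= !nth_incr_nth.
  have := nth_sorted_geq srt (leqnSn k).
  case: (eqVneq j k.+1) => [e|]; last by lia.
  by case: jP; rewrite e //=; lia.
apply/negP => /(nthP 0%N)[k]; rewrite size_incr_nth nth_incr_nth => ks.
case: (eqVneq j k) => //= jk fk0.
by have := nz k; move: fk0 ks jk; rewrite add0n => ->; case: ifP; lia.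
Qed.

Lemma AB_pt_bounds j : j = 0%N \/ (f j < f j.-1)%N ->
  (j < n)%N /\ 0 <= pt (f j) j.
Proof.
case: j => [|j] /=; last first.
  move=> [//|/[dup] /tau_la t /box_bounds[_ jn]]; split=> //.
  by move: t; rewrite /intau /pt; lia.
move=> _; split=> //; case E : (f 0%N) => [|i]; first by rewrite /pt; lia.
have : intau i 0 by apply: tau_la; rewrite E.
by rewrite /intau /pt; lia.
Qed.

(** For a point [(i, j)] outside [D], adding [n] leads into [D] exactly when
    [i] is the length of row [j], and adding [m] leads into [D] exactly when
    [(i, j - 1)] belongs to the partition, or [j = 0]. *)
Lemma AB_cogen : set_bij (AB la) (cogen m n D) box_pt.
Proof.
split.
- move=> b /ABP[j -> jP]; rewrite box_ptE /cogen /=.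
  have [hj p0] := AB_pt_bounds jP.
  split=> //.
  + by move=> /Dset_pt[//|_]; lia.
  + by rewrite ptDn; apply/Dset_pt => //; rewrite -ptDn; split; lia.
  + case: j jP hj p0 => [|j] jP hj p0.
      rewrite ptDm0; apply/Dset_pt; first by lia.
      rewrite -ptDm0; split; first by lia.
      case E : (f 0%N) => [|i]; first by lia.
      by have [|im _] := @box_bounds i 0; rewrite ?E //; lia.
    rewrite ptDm; apply/Dset_pt; first by lia.
    by rewrite -ptDm; case: jP => //= ?; split; lia.
- move=> b b' /set_mem/ABP[j -> jP] /set_mem/ABP[j' -> jP']; rewrite !box_ptE.
  have [hj _] := AB_pt_bounds jP; have [hj' _] := AB_pt_bounds jP'.
  by move=> /pt_inj[] // [->] ->.
- move=> k [k0 nD Dn Dm]; have [i [j [hj e]]] := pt_surj k.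
  rewrite e in k0 nD Dn Dm *.
  have fi : (f j)%:Z <= i.
    by rewrite leNgt; apply/negP => lt; apply: nD; apply/Dset_pt.
  have iE : i = (f j)%:Z.
    by rewrite ptDn in Dn; move/Dset_pt: Dn => [//|_]; lia.
  exists ((f j).+1, j.+1); last by rewrite box_ptE iE.
  apply/ABP; exists j => //; case: j hj Dm {e k0 nD Dn fi} iE => [|j] hj Dm iE.
    by left.
  by right; rewrite ptDm in Dm; move/Dset_pt: Dm => [|_ /=]; lia.
Qed.

Lemma xi_box_pt (b : box) : AB la b -> xi m n D (box_pt b) = xi_box m n la b.
Proof.
move=> ABb; rewrite (@xi_box_sum b _ erefl) xi_sum //.
by have [h _ _] := AB_cogen; have [? _ _ _] := h _ ABb; lia.
Qed.

Lemma ncard_AB : (ncard (AB la) <= n)%N.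
Proof.
rewrite (@ncard_row n _ (fun j => ((f j).+1, j.+1) : box)
  (fun j => (j == 0%N) || (f j < f j.-1)%N)) => [|i j _ _ [] //|b].
  apply: (@leq_trans (\sum_(j < n) 1)%N); last by rewrite sum1_card card_ord.
  by apply: leq_sum => j _; exact: leq_b1.
rewrite ABP; split=> [[j -> jP]|[j [_ jP ->]]].
  have [hj _] := AB_pt_bounds jP; exists j; split=> //.
  by case: jP => [->//|->]; rewrite orbT.
by exists j => //; case/orP: jP => [/eqP|]; [left|right].
Qed.

Lemma finite_AB : finite_set (AB la).
Proof.
apply: (@sub_finite_set _ _ ((fun j => ((f j).+1, j.+1)) @` `I_n)); last first.
  by apply: finite_image; exact: finite_II.
by move=> b /ABP[j -> jP]; exists j => //; have [] := AB_pt_bounds jP.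
Qed.

End Statistics.

(** Such a partition is determined by its number of rows, at most [n], and by
    row lengths that are at most [m]. *)
Lemma finite_Dyck : finite_set (Dyck m n l).
Proof.
pose h (x : 'I_n.+1 * {ffun 'I_n.+1 -> 'I_m.+1}) : seq nat :=
  mkseq (fun j => x.2 (inord j) : nat) x.1.
apply: (@sub_finite_set _ _ (h @` setT)); last first.
  by apply: finite_image; exact: finite_finset.
move=> la Dla; have le_m := nth_le_m Dla.
have sz : (size la <= n)%N.
  rewrite leqNgt; apply/negP => lt; have [_ la0 tau] := (DyckP la).1 Dla.
  have : nth 0%N la n != 0%N by apply: contraNneq la0 => <-; exact: mem_nth.
  by rewrite -lt0n => /tau/intau_bounds[_]; lia.
exists (inord (size la), [ffun j : 'I_n.+1 => inord (nth 0%N la j)]) => //.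
rewrite /h /= inordK ?ltnS //; apply: (@eq_from_nth _ 0%N).
  by rewrite size_mkseq.
move=> j; rewrite size_mkseq => hj; rewrite nth_mkseq // ffunE.
by rewrite !inordK ?ltnS ?le_m // (leq_trans (ltnW hj)).
Qed.

Lemma Dset_bij : set_bij (Dyck m n l) (Inv_w (w m n l))
  (fun la => Dset (nth 0%N la)).
Proof.
split=> [la|la mu /set_mem Dla /set_mem Dmu|D /Dset_surj[la]].
- exact: Dset_Inv_w.
- exact: Dset_inj.
- by exists la.
Qed.

Lemma codinv'_dinv (la : seq nat) : Dyck m n l la ->
  (ncard (tau m n l))%:Z - codinv' m n (Dset (nth 0%N la)) =
  (dinv m n la)%:Z.
Proof.
move=> Dla; rewrite codinv'_sum // dinv_sum // ncard_tau.
have [srt _ tau] := (DyckP la).1 Dla.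
by rewrite -(dinvf_codinvf srt tau) PoszD addrK.
Qed.

End LatticePoints.

(** * The product over addable boxes *)

Lemma fsbig_fin (R : Type) (idx : R) (op : Monoid.com_law idx) (T : finType)
    (P : {pred T}) (F : T -> R) :
  \big[op/idx]_(i \in [set` P]) F i = \big[op/idx]_(i | P i) F i.
Proof.
by rewrite [RHS]bigfs ?index_enum_uniq // => i _; rewrite mem_index_enum.
Qed.

(** Distributivity, with the subsets grouped by size. It is proved in the finite
    type of the elements of [A], whose sets [J] correspond to the subsets of
    [A]. *)
Lemma prod_1D_subsets (R : comNzRingType) (T : choiceType) (A : set T) (a : R)
    (c : T -> R) (N : nat) : finite_set A -> (ncard A < N)%N ->
  \big[*%R/1]_(b \in A) (1 + a * c b) =
  \sum_(k < N) a ^+ k * \sum_(L \in [set L : set T | L `<=` A /\ ncard L = k])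
    \big[*%R/1]_(b \in L) c b.
Proof.
move=> fA AN; pose X := fset_set A.
pose h (J : {set X}) : set T := val @` [set` J].
have hA J : h J `<=` A.
  move=> _ [x _ <-]; have := valP x.
  by rewrite /X in_fset_set // => /set_mem.
have hcard J : ncard (h J) = #|J|.
  rewrite (@ncard_image _ _ val (mem J)) => [|x y _ _|u]; last 2 first.
  - exact: val_inj.
  - by split=> [[x Jx <-]|[x Jx ->]]; exists x.
  by rewrite -sum1_card [RHS]big_mkcond.
have sub k : \sum_(L \in [set L : set T | L `<=` A /\ ncard L = k])
    \big[*%R/1]_(b \in L) c b =
    \sum_(J : {set X} | #|J| == k) \prod_(x in J) c (val x).
  rewrite (@reindex_fsbig _ _ _ _ _ h [set` [pred J : {set X} | #|J| == k]]).
    rewrite fsbig_fin; apply: eq_bigr => J _.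
    by rewrite fsbig_image ?fsbig_fin // => x y _ _; exact: val_inj.
  split=> [J /eqP <-|J J' _ _ e|L [LA <-]].
  - by split; [exact: hA | exact: hcard].
  - apply/setP => x; apply/idP/idP => xJ.
      have : h J (val x) by exists x.
      by rewrite e => -[y yJ /val_inj <-].
    have : h J' (val x) by exists x.
    by rewrite -e => -[y yJ /val_inj <-].
  - pose J := [set x : X | `[< L (val x) >]]%SET.
    have hJ : h J = L.
      apply/seteqP; split=> [_ [x + <-]|u Lu]; first by rewrite /= inE => /asboolP.
      have uX : u \in X by rewrite in_fset_set //; apply/mem_set/LA.
      by exists [` uX]%fset => //=; rewrite inE; apply/asboolP.
    by exists J => //; apply/eqP; rewrite -[in RHS]hJ hcard.
rewrite fsbig_finite // -/X big_seq_fsetE /=.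
under eq_bigr do rewrite addrC.
rewrite bigA_distr.
transitivity (\sum_(J : {set X}) a ^+ #|J| * \prod_(x in J) c (val x)).
  apply: eq_bigr => J _; rewrite -big_mkcond big_split /=; congr (_ * _).
  by rewrite prodr_const.
have ltN (J : {set X}) : (#|J| < N)%N.
  by rewrite -(hcard J); apply: leq_ltn_trans AN; apply: ncard_le.
rewrite (partition_big (fun J : {set X} => Ordinal (ltN J)) xpredT) //=.
apply: eq_bigr => k _; rewrite sub mulr_sumr; apply: eq_big => [J|J /eqP <- //].
by rewrite -val_eqE.
Qed.

Lemma exprz_fsum (R : comUnitRingType) (t : R) (T : choiceType) (L : set T)
    (x : T -> nat) : t \is a GRing.unit -> finite_set L ->
  t ^ (- \sum_(b \in L) (x b)%:Z) = \big[*%R/1]_(b \in L) t ^ (- (x b)%:Z).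
Proof.
move=> tU fL; rewrite !fsbig_finite // -sumrN.
exact: (big_morph (exprz t) (fun x y => exprzDr tU x y) (expr0z t)).
Qed.

Theorem theorem1 (m n : nat) (l : int) (R : comUnitRingType) (q t a : R)
    (hm : (0 < m)%N) (hn : (0 < n)%N) (hmn : coprime m n)
    (hl : 0 < l < (m * n)%N%:Z) (ht : t \is a GRing.unit) :
  Schroeder m n l q t a =
  \sum_(k \in [set: nat]) a ^+ k *
    (\sum_(la \in Dyck m n l)
       q ^+ area m n l la * t ^+ dinv m n la *
       \sum_(L \in [set L : set box | L `<=` AB la /\ ncard L = k])
         t ^ (- \sum_(b \in L) (xi_box m n la b)%:Z)).
Proof.
have fD := finite_Dyck hm hn hmn hl.
have fAB la : Dyck m n l la -> finite_set (AB la) by exact: finite_AB.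
(* at most n boxes are addable, so the sum over k is finite *)
rewrite -(@fsbig_widen _ _ _ _ `I_n.+1) //; last first.
  move=> k [_ /= /negP]; rewrite -leqNgt => nk.
  rewrite fsbig1 ?mulr0 // => la Dla; rewrite fsbig1 ?mulr0 // => L [LAB Lk].
  have := ncard_le (fAB _ Dla) LAB; have := ncard_AB hm hn hmn hl Dla.
  by rewrite Lk; lia.
rewrite -fsbig_ord.
under eq_bigr => k _ do rewrite fsbig_finite // mulr_sumr.
rewrite exchange_big /= -fsbig_finite //.
rewrite /Schroeder (@reindex_fsbig _ _ _ _ _ _ _ _ _ (Dset_bij hm hn hmn hl)) fsbig_distrr //.
apply: eq_fsbigr => la /set_mem Dla.
have tE : t ^+ ncard (tau m n l) * t ^ (- codinv' m n (Dset m n l (nth 0%N la)))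
    = t ^+ dinv m n la.
  rewrite -[t ^+ ncard _]/(t ^ (ncard (tau m n l))%:Z) -exprzDr //.
  by rewrite codinv'_dinv.
rewrite area'_sum // [LHS]mulrA [t ^+ _ * _]mulrCA tE.
under [RHS]eq_bigr do rewrite mulrCA.
rewrite -mulr_sumr; congr (_ * _).
have [AB0 ABn] := (finite_AB hm hn hmn hl Dla, ncard_AB hm hn hmn hl Dla).
rewrite (@reindex_fsbig _ _ _ _ _ _ _ _ _ (AB_cogen hm hn hmn hl Dla)).
transitivity (\big[*%R/1]_(b \in AB la) (1 + a * t ^ (- (xi_box m n la b)%:Z))).
  by apply: eq_fsbigr => b /set_mem ABb; rewrite (xi_box_pt hm hn hmn hl Dla ABb).
rewrite (@prod_1D_subsets _ _ _ _ _ n.+1) //.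
apply: eq_bigr => k _; congr (_ * _); apply: eq_fsbigr => L /set_mem[LAB _].
by rewrite exprz_fsum //; apply: sub_finite_set LAB _.
Qed.
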